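(* Fix $T>0$. For $0<h\ll1$, suppose that the equation $$-\varphi''+\varphi-2|\varphi|^2\varphi=i\alpha\varphi+h,\qquad -T\le x\le T,$$ with parameter $\alpha>0$, has a $2T$-periodic solution $\varphi$ with $\varphi=O(1)$. Then $\alpha=O(h)$. Precisely: for all constants $0<c_1\le c_2$ there exist $C>0$ and $h_0>0$ such that, whenever $0<h<h_0$, $\alpha>0$ and the equation has a complex-valued $2T$-periodic solution $\varphi$ with $c_1\le\|\varphi\|_{L^2[-T,T]}\le c_2$, one has $\alpha\le C h$.
   Context: The equation is the stationary equation of the Lugiato–Lefever model $iu_t+u_{xx}-u+2|u|^2u=-i\alpha u-h$ with $\alpha>0$, $h>0$ and periodic boundary conditions on $[-T,T]$. ''$\varphi=O(1)$'' means that $\varphi$ is of order one, i.e. its norm is bounded above and bounded away from zero, uniformly in $h$. *)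

(* Defs.v *)
From Stdlib Require Import Reals.
From Coquelicot Require Import Coquelicot.
Open Scope R_scope.

Definition periodic (p : R) (phi : R -> C) : Prop :=
  forall x : R, phi (x + p) = phi x.

(* The derivatives are with respect to the real variable [x], so [C] is taken
   as a normed module over [R]: this is not [C_derive]. *)
Definition twice_derivable (phi dphi ddphi : R -> C) : Prop :=
  forall x : R,
    @is_derive R_AbsRing C_R_NormedModule phi x (dphi x) /\
    @is_derive R_AbsRing C_R_NormedModule dphi x (ddphi x).

(* Solutions are classical; the equation forces [ddphi] to be continuous. *)
Definition periodic_solution (T alpha h : R) (phi : R -> C) : Prop :=
  periodic (2 * T) phi /\
  exists dphi ddphi : R -> C,
    twice_derivable phi dphi ddphi /\
    forall x : R, - T <= x <= T ->
      (- ddphi x + phi x - 2 * (Cmod (phi x) ^ 2)%R * phi x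
       = Ci * alpha * phi x + h)%C.

Definition L2_norm (T : R) (phi : R -> C) : R :=
  sqrt (RInt (fun x => Cmod (phi x) ^ 2) (- T) T).

(* Main.v *)
(** Pair the equation with the conjugate of [phi] and integrate the imaginary
    part over a period. The second-order term is the derivative of the periodic
    Wronskian of [Re phi] and [Im phi], so it integrates to zero, and what
    remains is [alpha * int |phi|^2 = h * int Im phi]; the right-hand side is
    at most [h * (T + int |phi|^2 / 2)]. *)
Require Import Defs.
From Stdlib Require Import Reals Lra.
From Coquelicot Require Import Coquelicot.
Open Scope R_scope.

Lemma is_derive_Re (f : R -> C) (x : R) (l : C) :
  @is_derive R_AbsRing C_R_NormedModule f x l ->
  is_derive (fun y => Re (f y)) x (Re l).
Proof.
  intros H.
  exact (filterdiff_comp' f fst x _ fst H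
           (filterdiff_linear fst is_linear_fst)).
Qed.

Lemma is_derive_Im (f : R -> C) (x : R) (l : C) :
  @is_derive R_AbsRing C_R_NormedModule f x l ->
  is_derive (fun y => Im (f y)) x (Im l).
Proof.
  intros H.
  exact (filterdiff_comp' f snd x _ snd H
           (filterdiff_linear snd is_linear_snd)).
Qed.

(** By the chain rule [df (x + p)] is a derivative at [x] of the shifted function, which is [f]
    itself; derivatives are unique. This closes up the Wronskian at the endpoints. *)
Lemma is_derive_periodic (p : R) (f df : R -> R) :
  (forall x, f (x + p) = f x) ->
  (forall x, is_derive f x (df x)) ->
  forall x, df (x + p) = df x.
Proof.
  intros Hper Hd x.
  rewrite <- (is_derive_unique f x (df x) (Hd x)).
  symmetry; apply is_derive_unique.
  apply (is_derive_ext (fun y => f (y + p))); [exact Hper|].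
  assert (Hs : is_derive (fun y => y + p) x 1) by (auto_derive; auto; ring).
  generalize (is_derive_comp f (fun y => y + p) x (df (x + p)) 1 (Hd _) Hs).
  unfold scal; simpl; unfold mult; simpl.
  now rewrite Rmult_1_l.
Qed.

Lemma Cmod_sqr (z : C) : Cmod z ^ 2 = Re z ^ 2 + Im z ^ 2.
Proof.
  unfold Cmod; rewrite pow2_sqrt; [reflexivity|].
  apply Rplus_le_le_0_compat; apply pow2_ge_0.
Qed.

(** In the product rule the two cross terms [du x * dv x] cancel. *)
Lemma wronskian_derive (u v du dv : R -> R) (x ddu ddv : R) :
  is_derive u x (du x) -> is_derive v x (dv x) ->
  is_derive du x ddu -> is_derive dv x ddv ->
  is_derive (fun y => u y * dv y - v y * du y) x (u x * ddv - v x * ddu).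
Proof.
  intros Hu Hv Hdu Hdv.
  assert (H := is_derive_minus _ _ _ _ _
                 (is_derive_mult u dv x _ _ Hu Hdv Rmult_comm)
                 (is_derive_mult v du x _ _ Hv Hdu Rmult_comm)).
  replace (u x * ddv - v x * ddu)
    with (du x * dv x + u x * ddv - (dv x * du x + v x * ddu)) by ring.
  exact H.
Qed.

Lemma mass_balance (T alpha h : R) (phi : R -> C) :
  0 < T -> periodic_solution T alpha h phi ->
  ex_RInt (fun x => Cmod (phi x) ^ 2) (- T) T /\
  is_RInt (fun x => h * Im (phi x) - alpha * Cmod (phi x) ^ 2) (- T) T 0.
Proof.
  intros HT [Hper [dphi [ddphi [Hd Heq]]]].
  set (u := fun x => Re (phi x)). set (v := fun x => Im (phi x)).
  set (du := fun x => Re (dphi x)). set (dv := fun x => Im (dphi x)).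
  assert (Hu : forall x, is_derive u x (du x))
    by (intros x; apply is_derive_Re, Hd).
  assert (Hv : forall x, is_derive v x (dv x))
    by (intros x; apply is_derive_Im, Hd).
  assert (Hdu : forall x, is_derive du x (Re (ddphi x)))
    by (intros x; apply is_derive_Re, Hd).
  assert (Hdv : forall x, is_derive dv x (Im (ddphi x)))
    by (intros x; apply is_derive_Im, Hd).
  assert (Hpu : forall x, u (x + 2 * T) = u x)
    by (intros x; unfold u; now rewrite Hper).
  assert (Hpv : forall x, v (x + 2 * T) = v x)
    by (intros x; unfold v; now rewrite Hper).
  assert (Cu : forall x, continuous u x)
    by (intros x; apply (ex_derive_continuous (V := R_NormedModule)); eexists; apply Hu).
  assert (Cv : forall x, continuous v x)
    by (intros x; apply (ex_derive_continuous (V := R_NormedModule)); eexists; apply Hv).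
  assert (Cm : forall x, continuous (fun y => Cmod (phi y) ^ 2) x).
  { intros x.
    assert (E : forall y : R, u y * u y + v y * v y = Cmod (phi y) ^ 2)
      by (intros y; rewrite Cmod_sqr; unfold u, v; ring).
    apply (continuous_ext _ _ _ E).
    apply (continuous_plus (V := R_NormedModule) (fun y => u y * u y) (fun y => v y * v y));
      [apply (continuous_mult (K := R_AbsRing) u u) | apply (continuous_mult (K := R_AbsRing) v v)]; auto. }
  split; [apply (ex_RInt_continuous (V := R_CompleteNormedModule)); auto|].
  set (w := fun x => u x * dv x - v x * du x).
  assert (Hw : w T - w (- T) = 0).
  { unfold w.
    (* Only the four occurrences coming from [w T] are shifted by a period; those in [w (- T)]
       stay. *)
    replace T with (- T + 2 * T) at 1 2 3 4 by ring.
    rewrite Hpu, Hpv, (is_derive_periodic _ _ _ Hpu Hu),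
      (is_derive_periodic _ _ _ Hpv Hv).
    ring. }
  rewrite <- Hw.
  apply (is_RInt_derive (V := R_CompleteNormedModule) w); intros x Hx.
  - rewrite Rmin_left, Rmax_right in Hx by lra.
    (* The equation turns the derivative of [w] into an expression in [phi] alone, whose continuity
       is already at hand. *)
    replace (h * Im (phi x) - alpha * Cmod (phi x) ^ 2)
      with (u x * Im (ddphi x) - v x * Re (ddphi x)).
    + now apply wronskian_derive.
    + specialize (Heq x Hx).
      pose proof (f_equal Re Heq) as HR. pose proof (f_equal Im Heq) as HI.
      rewrite Cmod_sqr in HR, HI |- *. unfold u, v.
      destruct (phi x) as [a b], (ddphi x) as [a2 b2].
      simpl in HR, HI |- *.
      (* The linear and cubic terms are real multiples of [(a, b)], so they cancel in
         [a * b2 - b * a2]. *)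
      assert (Ha : a2 = a - 2 * (a ^ 2 + b ^ 2) * a + alpha * b - h) by lra.
      assert (Hb : b2 = b - 2 * (a ^ 2 + b ^ 2) * b - alpha * a) by lra.
      rewrite Ha, Hb; ring.
  - apply (continuous_minus (V := R_NormedModule) (fun y => h * v y)
             (fun y => alpha * Cmod (phi y) ^ 2));
      apply (continuous_scal_r (K := R_AbsRing) (V := R_NormedModule)); auto.
Qed.

Theorem proposition3 :
  forall T : R, 0 < T ->
  forall c1 c2 : R, 0 < c1 -> c1 <= c2 ->
  exists K h0 : R, 0 < K /\ 0 < h0 /\
    forall (h alpha : R) (phi : R -> C),
      0 < h < h0 ->
      0 < alpha ->
      periodic_solution T alpha h phi ->
      c1 <= L2_norm T phi <= c2 ->
      alpha <= K * h.
Proof.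
  intros T HT c1 c2 Hc1 _.
  assert (Hc1' : 0 < c1 ^ 2) by now apply pow_lt.
  assert (HTc : 0 < T / c1 ^ 2) by now apply Rdiv_lt_0_compat.
  (* Dividing [alpha * I <= h * (T + I / 2)] by [I >= c1 ^ 2] gives this constant, [I] being the
     integral of [|phi|^2]. *)
  exists (T / c1 ^ 2 + 1 / 2), 1.
  split; [lra|split; [lra|]].
  intros h alpha phi [Hh _] Ha Hsol [HN _].
  destruct (mass_balance T alpha h phi HT Hsol) as [Hex Hbal].
  unfold L2_norm in HN.
  set (m := fun x => Cmod (phi x) ^ 2) in *.
  set (I := RInt m (- T) T) in *.
  assert (HI : c1 ^ 2 <= I).
  { destruct (Rle_or_lt 0 I) as [HI0|HI0].
    - rewrite <- (pow2_sqrt I HI0). apply pow_incr; lra.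
    - rewrite sqrt_neg_0 in HN; lra. }
  (* This majorant of the balance integrand comes from [Im z <= (1 + |z|^2) / 2]. *)
  assert (Hup : is_RInt (fun x => h / 2 + (h / 2 - alpha) * m x) (- T) T
                  ((T - - T) * (h / 2) + (h / 2 - alpha) * I)).
  { apply (is_RInt_plus (V := R_NormedModule)
             (fun _ => h / 2) (fun x => (h / 2 - alpha) * m x)).
    - apply (is_RInt_const (V := R_NormedModule)).
    - apply (is_RInt_scal (V := R_NormedModule) m).
      exact (RInt_correct (V := R_CompleteNormedModule) m _ _ Hex). }
  assert (Hle : 0 <= (T - - T) * (h / 2) + (h / 2 - alpha) * I).
  { refine (is_RInt_le _ _ _ _ _ _ _ Hbal Hup _); [lra|].
    intros x _. unfold m. rewrite Cmod_sqr.
    generalize (Re (phi x)) (Im (phi x)); intros a b.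
    (* Half of this product is exactly the gap between the two integrands. *)
    pose proof (Rmult_le_pos h ((1 - b) ^ 2 + a ^ 2)) as Hsq.
    pose proof (pow2_ge_0 (1 - b)); pose proof (pow2_ge_0 a).
    lra. }
  assert (HTI : T <= T / c1 ^ 2 * I).
  { replace T with (T / c1 ^ 2 * c1 ^ 2) at 1 by (field; lra).
    apply Rmult_le_compat_l; lra. }
  assert (HTh : h * T <= h * (T / c1 ^ 2 * I)) by (apply Rmult_le_compat_l; lra).
  (* After multiplication by [I > 0], [Hle] and [HTh] combine linearly. *)
  apply (Rmult_le_reg_r I); lra.
Qed.
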